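(* The composite $\mathcal{T}\mathcal{M}:\mathbf{wMSum}\to\mathbf{MSum}$, sending a weakly multiplicative summation $\mathfrak{S}$ to $\mathcal{T}(\mathcal{M}\mathfrak{S})$, is an idempotent extension map which subsumes $\mathcal{M}$, $\mathcal{T}$, and $\mathcal{M}\mathcal{T}$.
   Context: Let $R$ be a commutative unital ring with $0\neq 1$ and $E$ a commutative unital $R$-algebra with $0\neq 1$. A *summation on $R$ to $E$* is a tuple $(R,E,D,\mathfrak{S})$, abbreviated $(D,\mathfrak{S})$ or $\mathfrak{S}$, where $D$ is a set and $\mathfrak{S}:D\to E$ a map such that: (I) $R[\sigma]\subseteq D\subseteq R[[\sigma]]$; (II) $D$ is an $R$-module and $\mathfrak{S}$ is an $R$-module homomorphism; (III) $\mathfrak{S}(1)=1$; (IV) $(1-\sigma)D\subseteq D$ and $\mathfrak{S}$ factors through $D/(1-\sigma)D$ (i.e. $\mathfrak{S}((1-\sigma)X)=0$ for all $X\in D$). For summations $(D,\mathfrak{S})$, $(D',\mathfrak{S}')$ on the same $R$ to the same $E$, $\mathfrak{S}'$ *extends* $\mathfrak{S}$, written $\mathfrak{S}\subseteq\mathfrak{S}'$, if $D\subseteq D'$ and $\mathfrak{S}'|_D=\mathfrak{S}$. $\mathbf{Sum}$ is the posetal category whose objects are all summations and whose morphisms are extensions. A summation $(D,\mathfrak{S})$ is *multiplicative* if $D$ is an $R$-algebra (a subring of $R[[\sigma]]$) and $\mathfrak{S}$ is an $R$-algebra homomorphism; it is *weakly multiplicative* if it has an extension which is multiplicative. $\mathbf{MSum}\subseteq\mathbf{wMSum}$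 are the full subcategories of $\mathbf{Sum}$ on the multiplicative and weakly multiplicative summations. For functors $\mathcal{F},\mathcal{G}$ on $\mathbf{wMSum}$ (with values in $\mathbf{wMSum}$): $\mathcal{F}$ is an *extension map* if $\mathcal{F}\mathfrak{S}\supseteq\mathfrak{S}$ for every $\mathfrak{S}$; $\mathcal{F}$ *subsumes* $\mathcal{G}$ if $\mathcal{F}=\mathcal{F}\circ\mathcal{G}=\mathcal{G}\circ\mathcal{F}$; $\mathcal{F}$ is *idempotent* if $\mathcal{F}\circ\mathcal{F}=\mathcal{F}$. $\mathrm{Reg}(E)$ is the set of non-zerodivisors of $E$. *Telescopic extension* $(\mathcal{T}D,\mathcal{T}\mathfrak{S})$ of a summation $(D,\mathfrak{S})$: $X\in R[[\sigma]]$ belongs to $\mathcal{T}D$ iff there exist $A\in D$, $F\in R[\sigma]$, $f\in\mathrm{Reg}(E)$, $x\in E$ with $A=FX$, $\mathfrak{S}(F)=f$, $\mathfrak{S}(A)=fx$; then $\mathcal{T}\mathfrak{S}(X):=x$. *Multiplicative extension* $(\mathcal{M}D,\mathcal{M}\mathfrak{S})$ of a weakly multiplicative summation $(D,\mathfrak{S})$: $X\in R[[\sigma]]$ belongs to $\mathcal{M}D$ iff $X=\sum_{i=1}^{\ell}\prod_{j=1}^{k_i}X_{i,j}$ for some $\ell,k_i\in\mathbb{N}=\{0,1,2,\dots\}$ and $X_{i,j}\in D$; then $\mathcal{M}\mathfrak{S}(X):=\sum_{i=1}^{\ell}\prod_{j=1}^{k_i}\mathfrak{S}(X_{i,j})$.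 (Both are well defined; $\mathcal{T}$ maps $\mathbf{wMSum}$ to $\mathbf{wMSum}$ and $\mathbf{MSum}$ to $\mathbf{MSum}$; $\mathcal{M}$ maps $\mathbf{wMSum}$ to $\mathbf{MSum}$.) *)

(* Defs.v *)
From HB Require Import structures.
From mathcomp Require Import all_boot all_order all_algebra.
From mathcomp Require Import boolp classical_sets.

Set Implicit Arguments.
Unset Strict Implicit.
Unset Printing Implicit Defensive.

Import GRing.Theory.
Local Open Scope ring_scope.
Local Open Scope classical_set_scope.

(* The ring R[[sigma]]: coefficient sequences with the Cauchy product. The
   record wrapper keeps the pointwise product on nat -> R out of the way. *)
Record fps (R : Type) := Fps { coefs : nat -> R }.

HB.instance Definition _ (R : Type) := gen_eqMixin (fps R).
HB.instance Definition _ (R : Type) := gen_choiceMixin (fps R).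

Section PowerSeries.
Variable R : comNzRingType.
Implicit Types X Y Z : fps R.

Lemma fpsP X Y : (forall n, coefs X n = coefs Y n) -> X = Y.
Proof. by case: X Y => [x] [y] /= xy; congr Fps; apply: funext. Qed.

Definition fps_zero : fps R := Fps (fun=> 0).
Definition fps_opp X : fps R := Fps (fun n => - coefs X n).
Definition fps_add X Y : fps R := Fps (fun n => coefs X n + coefs Y n).
Definition fps_scale (a : R) X : fps R := Fps (fun n => a * coefs X n).
Definition fps_one : fps R := Fps (fun n => (n == 0)%:R).
Definition fps_mul X Y : fps R :=
  Fps (fun n => \sum_(i < n.+1) coefs X i * coefs Y (n - i)).

Fact fps_addA : associative fps_add.
Proof. by move=> X Y Z; apply: fpsP => n /=; rewrite addrA. Qed.
Fact fps_addC : commutative fps_add.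
Proof. by move=> X Y; apply: fpsP => n /=; rewrite addrC. Qed.
Fact fps_add0 : left_id fps_zero fps_add.
Proof. by move=> X; apply: fpsP => n /=; rewrite add0r. Qed.
Fact fps_addN : left_inverse fps_zero fps_opp fps_add.
Proof. by move=> X; apply: fpsP => n /=; rewrite addNr. Qed.

HB.instance Definition _ := GRing.isZmodule.Build (fps R)
  fps_addA fps_addC fps_add0 fps_addN.

Let trunc n X : {poly R} := \poly_(i < n.+1) coefs X i.

Let coef_trunc n X i : (i <= n)%N -> (trunc n X)`_i = coefs X i.
Proof. by move=> le_in; rewrite coef_poly ltnS le_in. Qed.

Let coef_mulE n X Y i : (i <= n)%N ->
  coefs (fps_mul X Y) i = (trunc n X * trunc n Y)`_i.
Proof.
move=> le_in; rewrite coefM /=; apply: eq_bigr => j _.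
rewrite !coef_trunc //; first exact: leq_trans (leq_subr _ _) le_in.
by apply: leq_trans le_in; rewrite -ltnS.
Qed.

Fact fps_mulA : associative fps_mul.
Proof.
move=> X Y Z; apply: fpsP => n.
transitivity ((trunc n X * (trunc n Y * trunc n Z))`_n).
  rewrite coefM /=; apply: eq_bigr => j _.
  rewrite coef_trunc; last by rewrite -ltnS.
  by rewrite -(coef_mulE Y Z) // leq_subr.
rewrite mulrA coefM /=; apply: eq_bigr => j _.
by rewrite coef_trunc ?leq_subr // -(coef_mulE X Y) // -ltnS.
Qed.

Fact fps_mulC : commutative fps_mul.
Proof.
by move=> X Y; apply: fpsP => n; rewrite !(@coef_mulE n) // mulrC.
Qed.

Fact fps_mul1 : left_id fps_one fps_mul.
Proof.
move=> X; apply: fpsP => n /=; rewrite big_ord_recl /= mul1r subn0.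
by rewrite big1 ?addr0 // => i _; rewrite mul0r.
Qed.

Fact fps_mulDl : left_distributive fps_mul fps_add.
Proof.
move=> X Y Z; apply: fpsP => n /=; rewrite -big_split /=.
by apply: eq_bigr => i _; rewrite mulrDl.
Qed.

Fact fps_one_neq0 : fps_one != 0.
Proof.
by apply/eqP => /(congr1 (fun X => coefs X 0)) /= /eqP; rewrite oner_eq0.
Qed.

HB.instance Definition _ := GRing.Zmodule_isComNzRing.Build (fps R)
  fps_mulA fps_mulC fps_mul1 fps_mulDl fps_one_neq0.

Fact fps_scaleA a b X : fps_scale a (fps_scale b X) = fps_scale (a * b) X.
Proof. by apply: fpsP => n /=; rewrite mulrA. Qed.
Fact fps_scale1 : left_id 1 fps_scale.
Proof. by move=> X; apply: fpsP => n /=; rewrite mul1r. Qed.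
Fact fps_scaleDr : right_distributive fps_scale +%R.
Proof. by move=> a X Y; apply: fpsP => n /=; rewrite mulrDr. Qed.
Fact fps_scaleDl X : {morph fps_scale^~ X : a b / a + b}.
Proof. by move=> a b; apply: fpsP => n /=; rewrite mulrDl. Qed.

HB.instance Definition _ := GRing.Zmodule_isLmodule.Build R (fps R)
  fps_scaleA fps_scale1 fps_scaleDr fps_scaleDl.

Fact fps_scaleAl (a : R) X Y : a *: (X * Y) = a *: X * Y.
Proof.
apply: fpsP => n /=; rewrite mulr_sumr.
by apply: eq_bigr => i _; rewrite mulrA.
Qed.

HB.instance Definition _ := GRing.Lmodule_isLalgebra.Build R (fps R)
  fps_scaleAl.
HB.instance Definition _ := GRing.Lalgebra_isComAlgebra.Build R (fps R).

(* The inclusion of R[sigma] in R[[sigma]]. *)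
Definition fps_of_poly (p : {poly R}) : fps R := Fps (fun n => p`_n).

Definition fps_sigma : fps R := fps_of_poly 'X.

Lemma fps_of_polyD p q : fps_of_poly (p + q) = fps_of_poly p + fps_of_poly q.
Proof. by apply: fpsP => n /=; rewrite coefD. Qed.

Lemma fps_of_polyM p q : fps_of_poly (p * q) = fps_of_poly p * fps_of_poly q.
Proof. by apply: fpsP => n /=; rewrite coefM. Qed.

Lemma fps_of_polyC c : fps_of_poly c%:P = c *: 1.
Proof.
apply: fpsP => n /=; rewrite coefC.
by case: eqP => _; rewrite ?mulr1 ?mulr0.
Qed.

Lemma fps_of_poly1 : fps_of_poly 1 = 1.
Proof. by rewrite fps_of_polyC scale1r. Qed.

End PowerSeries.

(* Elements of the type sdom are pairs of a series X and a proof of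
   X \in sdom, so that sfun is a function on the domain only and two summations
   are equal as soon as they have the same domain and the same values. *)
Record summation (R : comNzRingType) (E : comAlgType R) := Summation {
  sdom : set (fps R);
  sfun : sdom -> E;
  sdom_poly : forall F : {poly R}, sdom (fps_of_poly F);
  sdom_lin : forall (a : R) X Y, sdom X -> sdom Y -> sdom (a *: X + Y);
  sfun_lin : forall (a : R) (X Y Z : sdom),
    val Z = a *: val X + val Y -> sfun Z = a *: sfun X + sfun Y;
  sfun1 : forall Z : sdom, val Z = 1 -> sfun Z = 1;
  sdom_tel : forall X, sdom X -> sdom ((1 - fps_sigma R) * X);
  sfun_tel : forall X Z : sdom,
    val Z = (1 - fps_sigma R) * val X -> sfun Z = 0
}.
Coercion sfun : summation >-> Funclass.

Section Summations.
Variables (R : comNzRingType) (E : comAlgType R).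
Implicit Types (S : summation E) (X Y : fps R) (x y : E).

Definition extends S S' : Prop :=
  sdom S `<=` sdom S' /\
  forall (X : sdom S) (X' : sdom S'), val X = val X' -> S X = S' X'.

Definition multiplicative S : Prop :=
  (forall X Y, sdom S X -> sdom S Y -> sdom S (X * Y)) /\
  (forall X Y Z : sdom S, val Z = val X * val Y -> S Z = S X * S Y).

Definition weakly_multiplicative S : Prop :=
  exists S' : summation E, extends S S' /\ multiplicative S'.

Definition sgraph S X x : Prop := exists Z : sdom S, val Z = X /\ S Z = x.

Lemma sgraph_val S (Z : sdom S) : sgraph S (val Z) (S Z).
Proof. by exists Z. Qed.

Lemma sgraph_dom S X : sdom S X -> exists x, sgraph S X x.
Proof.
by move=> SX; eexists; apply: (sgraph_val (exist _ X (mem_set SX))).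
Qed.

Lemma sgraph_sdom S X x : sgraph S X x -> sdom S X.
Proof. by move=> [[Z SZ] [<- _]]; apply: set_mem. Qed.

Lemma sgraph_fun S X x y : sgraph S X x -> sgraph S X y -> x = y.
Proof.
move=> [Z [ZX <-]] [Z' [ZX' <-]].
by have -> : Z = Z' by apply: val_inj; rewrite /= ZX.
Qed.

Lemma sgraph_lin S a X Y x y :
  sgraph S X x -> sgraph S Y y -> sgraph S (a *: X + Y) (a *: x + y).
Proof.
move=> SX SY; have [z SZ] := sgraph_dom (sdom_lin a (sgraph_sdom SX) (sgraph_sdom SY)).
move: SX SY SZ (SZ) => [X1 [<- <-]] [Y1 [<- <-]] [Z1 [Z1E <-]] .
by rewrite (sfun_lin Z1E).
Qed.

Lemma sgraph_tel S X x : sgraph S X x -> sgraph S ((1 - fps_sigma R) * X) 0.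
Proof.
move=> SX; have [z SZ] := sgraph_dom (sdom_tel (sgraph_sdom SX)).
by move: SX SZ (SZ) => [X1 [<- _]] [Z1 [Z1E <-]]; rewrite (sfun_tel Z1E).
Qed.

Lemma sgraph1 S : sgraph S 1 1.
Proof.
have := sdom_poly S 1; rewrite fps_of_poly1 => /sgraph_dom [z SZ].
by move: SZ (SZ) => [Z1 [Z1E <-]]; rewrite (sfun1 Z1E).
Qed.

Lemma sgraph0 S : sgraph S 0 0.
Proof.
have := sgraph_lin (-1) (sgraph1 S) (sgraph1 S).
by rewrite !scaleN1r !addNr.
Qed.

Lemma sgraphD S X Y x y :
  sgraph S X x -> sgraph S Y y -> sgraph S (X + Y) (x + y).
Proof. by move=> SX SY; have := sgraph_lin 1 SX SY; rewrite !scale1r. Qed.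

Lemma sgraphZ S a X x : sgraph S X x -> sgraph S (a *: X) (a *: x).
Proof. by move=> SX; have := sgraph_lin a SX (sgraph0 S); rewrite !addr0. Qed.

Lemma sgraph_sigma S X x : sgraph S X x -> sgraph S (fps_sigma R * X) x.
Proof.
move=> SX; have := sgraph_lin (-1) (sgraph_tel SX) SX.
by rewrite !scaleN1r oppr0 add0r -mulNr opprB mulrBl mul1r subrK.
Qed.

(* A summation is shift invariant, hence acts on R[sigma] by evaluation at 1. *)
Lemma sgraph_polyM S F X x :
  sgraph S X x -> sgraph S (fps_of_poly F * X) (F.[1] *: x).
Proof.
elim/poly_ind: F X x => [|F c IH] X x SX.
  by rewrite horner0 scale0r fps_of_polyC scale0r mul0r; apply: sgraph0.
rewrite fps_of_polyD fps_of_polyM fps_of_polyC mulrDl -mulrA -scalerAl mul1r.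
rewrite hornerMXaddC mulr1 scalerDl; apply: sgraphD; last exact: sgraphZ.
by apply: IH; apply: sgraph_sigma.
Qed.

Lemma sgraph_poly S F : sgraph S (fps_of_poly F) (F.[1] *: 1).
Proof. by have := sgraph_polyM F (sgraph1 S); rewrite mulr1. Qed.

Lemma extendsP S S' :
  extends S S' <-> (forall X x, sgraph S X x -> sgraph S' X x).
Proof.
split=> [[sSS' eqS] X x SX | sub].
  have [x' SX'] := sgraph_dom (sSS' _ (sgraph_sdom SX)).
  by move: SX SX' (SX') => [Z [ZX <-]] [Z' [ZX' <-]]; rewrite (eqS Z Z') // ZX.
split=> [X SX | X X' XX'].
  by have [x /sub/sgraph_sdom] := sgraph_dom SX.
by apply: (@sgraph_fun S' (val X)); [apply/sub/sgraph_val | rewrite XX'; apply: sgraph_val].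
Qed.

Lemma extends_refl S : extends S S.
Proof. exact/extendsP. Qed.

Lemma extends_trans S S' S'' : extends S S' -> extends S' S'' -> extends S S''.
Proof.
by move=> /extendsP sSS' /extendsP sS'S''; apply/extendsP => X x /sSS'/sS'S''.
Qed.

Lemma extends_antisym S S' : extends S S' -> extends S' S -> S = S'.
Proof.
move=> [sSS' eqS] [sS'S _].
have eqD : sdom S = sdom S' by apply/seteqP.
case: S S' eqD eqS {sSS' sS'S} => [D s p1 p2 p3 p4 p5 p6] [D' s' p1' p2' p3' p4' p5' p6'] /=.
move=> eqD; move: eqD s' p1' p2' p3' p4' p5' p6' => <- s' p1' p2' p3' p4' p5' p6' eqS.
have eqs : s = s' by apply: funext => X; exact: eqS.
move: eqs p3' p4' p6' {eqS} => <- p3' p4' p6'.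
by congr Summation; apply: Prop_irrelevance.
Qed.

Lemma sgraphM S X Y x y : multiplicative S ->
  sgraph S X x -> sgraph S Y y -> sgraph S (X * Y) (x * y).
Proof.
move=> [SM SvM] SX SY; have [z SZ] := sgraph_dom (SM _ _ (sgraph_sdom SX) (sgraph_sdom SY)).
move: SX SY SZ (SZ) => [X1 [<- <-]] [Y1 [<- <-]] [Z1 [Z1E <-]] .
by rewrite (SvM _ _ _ Z1E).
Qed.

Lemma multiplicativeP S :
  (forall X Y x y, sgraph S X x -> sgraph S Y y -> sgraph S (X * Y) (x * y)) ->
  multiplicative S.
Proof.
move=> SM; split=> [X Y | X Y Z ZXY].
  by move=> /sgraph_dom[x SX] /sgraph_dom[y SY]; exact: sgraph_sdom (SM _ _ _ _ SX SY).
apply: (@sgraph_fun S (val Z)); first exact: sgraph_val.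
by rewrite ZXY; apply: SM; apply: sgraph_val.
Qed.

(* The summation with a given graph G; its domain is [set X | exists x, G X x]. *)
Section OfGraph.
Variable G : fps R -> E -> Prop.
Hypothesis Gfun : forall X x y, G X x -> G X y -> x = y.
Hypothesis Gpoly : forall F : {poly R}, exists x, G (fps_of_poly F) x.
Hypothesis Glin : forall (a : R) X Y x y,
  G X x -> G Y y -> G (a *: X + Y) (a *: x + y).
Hypothesis G1 : G 1 1.
Hypothesis Gtel : forall X x, G X x -> G ((1 - fps_sigma R) * X) 0.

Definition graph_dom : set (fps R) := [set X | exists x, G X x].

Definition graph_val (X : graph_dom) : E := projT1 (cid (set_mem (valP X))).

Lemma graph_valP (X : graph_dom) : G (val X) (graph_val X).
Proof. exact: projT2 (cid _). Qed.

Fact graph_dom_lin (a : R) X Y :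
  graph_dom X -> graph_dom Y -> graph_dom (a *: X + Y).
Proof. by move=> [x GX] [y GY]; exists (a *: x + y); apply: Glin. Qed.

Fact graph_val_lin (a : R) (X Y Z : graph_dom) :
  val Z = a *: val X + val Y -> graph_val Z = a *: graph_val X + graph_val Y.
Proof.
move=> ZE; apply: (Gfun (graph_valP Z)).
by rewrite ZE; apply: Glin; apply: graph_valP.
Qed.

Fact graph_val1 (Z : graph_dom) : val Z = 1 -> graph_val Z = 1.
Proof. by move=> ZE; apply: (Gfun (graph_valP Z)); rewrite ZE. Qed.

Fact graph_dom_tel X : graph_dom X -> graph_dom ((1 - fps_sigma R) * X).
Proof. by move=> [x /Gtel GX]; exists 0. Qed.

Fact graph_val_tel (X Z : graph_dom) :
  val Z = (1 - fps_sigma R) * val X -> graph_val Z = 0.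
Proof.
move=> ZE; apply: (Gfun (graph_valP Z)).
by rewrite ZE; apply: Gtel (graph_valP X).
Qed.

Definition graph_summation : summation E :=
  @Summation R E graph_dom graph_val Gpoly graph_dom_lin graph_val_lin
    graph_val1 graph_dom_tel graph_val_tel.

Lemma graph_summationE X x : sgraph graph_summation X x <-> G X x.
Proof.
split=> [[Z [<- <-]] | GX]; first exact: graph_valP.
have dX : graph_dom X by exists x.
by exists (exist _ X (mem_set dX)); split=> //; apply: (Gfun (graph_valP _)).
Qed.

End OfGraph.

Definition spoly S (F : {poly R}) : sdom S :=
  exist _ (fps_of_poly F) (mem_set (sdom_poly S F)).

Lemma spolyE S F : S (spoly S F) = F.[1] *: 1.
Proof. exact: sgraph_fun (sgraph_val (spoly S F)) (sgraph_poly S F). Qed.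

(* "X is in the domain of the telescopic extension, with value x". *)
Definition tele_graph S X x : Prop :=
  exists (A : sdom S) (F : {poly R}) (f : E),
    [/\ GRing.lreg f, val A = fps_of_poly F * X, S (spoly S F) = f
      & S A = f * x].

Lemma tele_graphP S X x : tele_graph S X x <->
  exists2 F : {poly R}, GRing.lreg (F.[1] *: 1 : E) &
    sgraph S (fps_of_poly F * X) (F.[1] *: x).
Proof.
split=> [[A [F [f [fR AE]]]] | [F FR [A [AE SA]]]].
  by rewrite spolyE => fE SA; exists F; rewrite ?fE // -AE -[x]mul1r scalerAl fE -SA; eexists.
exists A, F, (F.[1] *: 1); split=> //; first exact: spolyE.
by rewrite SA -scalerAl mul1r.
Qed.

Lemma tele_graph_ext S X x : sgraph S X x -> tele_graph S X x.
Proof.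
move=> SX; apply/tele_graphP; exists 1; last first.
  by rewrite fps_of_poly1 mul1r hornerE scale1r.
by rewrite hornerE scale1r; apply: lreg1.
Qed.

Fact tele_graph_fun S X x y : tele_graph S X x -> tele_graph S X y -> x = y.
Proof.
move=> /tele_graphP[F FR SF] /tele_graphP[G GR SG].
have:= sgraph_polyM F SG; have:= sgraph_polyM G SF.
rewrite mulrCA => SFG /(sgraph_fun SFG) e; apply: GR; apply: FR.
by rewrite -!scalerAl !mul1r scalerA mulrC -scalerA.
Qed.

Fact tele_graph_poly S F : exists x, tele_graph S (fps_of_poly F) x.
Proof. by exists (F.[1] *: 1); apply/tele_graph_ext/sgraph_poly. Qed.

Let lregM1 (a b : R) : GRing.lreg (a *: 1 : E) -> GRing.lreg (b *: 1 : E) ->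
  GRing.lreg ((a * b) *: 1 : E).
Proof.
by move=> aR bR; rewrite -scalerA -[b *: 1]mul1r scalerAl; apply: lregM.
Qed.

Fact tele_graph_lin S (a : R) X Y x y : tele_graph S X x -> tele_graph S Y y ->
  tele_graph S (a *: X + Y) (a *: x + y).
Proof.
move=> /tele_graphP[F FR SF] /tele_graphP[G GR SG].
apply/tele_graphP; exists (F * G); first by rewrite hornerM; apply: lregM1.
have:= sgraph_lin a (sgraph_polyM G SF) (sgraph_polyM F SG).
rewrite fps_of_polyM hornerM mulrDr -scalerAr scalerDr !scalerA.
by rewrite !mulrA (mulrC (fps_of_poly G)) (mulrAC a) [_ * a]mulrC mulrA.
Qed.

Fact tele_graph1 S : tele_graph S 1 1.
Proof. exact/tele_graph_ext/sgraph1. Qed.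

Fact tele_graph_tel S X x :
  tele_graph S X x -> tele_graph S ((1 - fps_sigma R) * X) 0.
Proof.
move=> /tele_graphP[F FR SF]; apply/tele_graphP; exists F => //.
by rewrite scaler0 mulrCA; apply: sgraph_tel SF.
Qed.

Definition telescopic_ext S : summation E :=
  graph_summation (@tele_graph_fun S) (@tele_graph_poly S) (@tele_graph_lin S)
    (@tele_graph1 S) (@tele_graph_tel S).

Lemma telescopic_extE S X x : sgraph (telescopic_ext S) X x <-> tele_graph S X x.
Proof. exact: graph_summationE. Qed.

Lemma telescopic_ext_extends S : extends S (telescopic_ext S).
Proof. by apply/extendsP => X x /tele_graph_ext; rewrite telescopic_extE. Qed.

Lemma telescopic_ext_mono S S' :
  extends S S' -> extends (telescopic_ext S) (telescopic_ext S').
Proof.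
move=> /extendsP sSS'; apply/extendsP => X x; rewrite !telescopic_extE.
by rewrite !tele_graphP => -[F FR /sSS' SF]; exists F.
Qed.

Lemma telescopic_ext_multiplicative S :
  multiplicative S -> multiplicative (telescopic_ext S).
Proof.
move=> SM; apply: multiplicativeP => X Y x y; rewrite !telescopic_extE !tele_graphP.
move=> [F FR SF] [G GR SG]; exists (F * G); first by rewrite hornerM; apply: lregM1.
rewrite fps_of_polyM hornerM mulrACA -scalerA scalerAr scalerAl.
exact: sgraphM.
Qed.

Lemma telescopic_ext_weakly_multiplicative S :
  weakly_multiplicative S -> weakly_multiplicative (telescopic_ext S).
Proof.
move=> [S' [sSS' S'M]]; exists (telescopic_ext S'); split.
  exact: telescopic_ext_mono.
exact: telescopic_ext_multiplicative.
Qed.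

(* "X is in the domain of the multiplicative extension, with value x": the
   sequence s lists, for each i, the sequence of the X_(i,j); s and its members
   may be empty. *)
Definition mult_graph S X x : Prop :=
  exists s : seq (seq (sdom S)),
    X = \sum_(t <- s) \prod_(Z <- t) val Z /\
    x = \sum_(t <- s) \prod_(Z <- t) S Z.

Lemma mult_graph_ext S X x : sgraph S X x -> mult_graph S X x.
Proof.
by move=> [Z [<- <-]]; exists [:: [:: Z]]; rewrite !big_cons !big_nil !addr0 !mulr1.
Qed.

Lemma mult_graph_sub S S' X x : extends S S' -> multiplicative S' ->
  mult_graph S X x -> sgraph S' X x.
Proof.
move=> /extendsP sSS' S'M [s [-> ->]].
elim/big_ind2: _ => [|X1 x1 X2 x2|t _]; [exact: sgraph0 | exact: sgraphD |].
elim/big_ind2: _ => [|X1 x1 X2 x2|Z _]; [exact: sgraph1 | exact: sgraphM |].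
exact/sSS'/sgraph_val.
Qed.

Lemma mult_graphD S X Y x y :
  mult_graph S X x -> mult_graph S Y y -> mult_graph S (X + Y) (x + y).
Proof. by move=> [s [-> ->]] [t [-> ->]]; exists (s ++ t); rewrite !big_cat. Qed.

Lemma mult_graphM S X Y x y :
  mult_graph S X x -> mult_graph S Y y -> mult_graph S (X * Y) (x * y).
Proof.
move=> [s [-> ->]] [t [-> ->]]; exists [seq u ++ v | u <- s, v <- t].
rewrite !big_allpairs_dep !mulr_suml; split; apply: eq_bigr => u _;
  rewrite mulr_sumr; apply: eq_bigr => v _; by rewrite big_cat.
Qed.

Fact mult_graph_fun S (wS : weakly_multiplicative S) X x y :
  mult_graph S X x -> mult_graph S X y -> x = y.
Proof.
have [S' [sSS' S'M]] := wS; move=> /(mult_graph_sub sSS' S'M) h.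
by move=> /(mult_graph_sub sSS' S'M); apply: sgraph_fun.
Qed.

Fact mult_graph_poly S F : exists x, mult_graph S (fps_of_poly F) x.
Proof. by exists (F.[1] *: 1); apply/mult_graph_ext/sgraph_poly. Qed.

Fact mult_graph_lin S (a : R) X Y x y : mult_graph S X x -> mult_graph S Y y ->
  mult_graph S (a *: X + Y) (a *: x + y).
Proof.
move=> SX SY; apply: mult_graphD => //.
rewrite -[X]mul1r -[x]mul1r !scalerAl; apply: mult_graphM => //.
exact/mult_graph_ext/sgraphZ/sgraph1.
Qed.

Fact mult_graph1 S : mult_graph S 1 1.
Proof. exact/mult_graph_ext/sgraph1. Qed.

Fact mult_graph_tel S X x :
  mult_graph S X x -> mult_graph S ((1 - fps_sigma R) * X) 0.
Proof.
move=> SX; rewrite -[0](mul0r x); apply: mult_graphM => //.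
by apply: mult_graph_ext; have := sgraph_tel (sgraph1 S); rewrite mulr1.
Qed.

Definition multiplicative_ext S (wS : weakly_multiplicative S) : summation E :=
  graph_summation (@mult_graph_fun S wS) (@mult_graph_poly S)
    (@mult_graph_lin S) (@mult_graph1 S) (@mult_graph_tel S).

Lemma multiplicative_extE S (wS : weakly_multiplicative S) X x :
  sgraph (multiplicative_ext wS) X x <-> mult_graph S X x.
Proof. exact: graph_summationE. Qed.

Lemma multiplicative_ext_extends S (wS : weakly_multiplicative S) :
  extends S (multiplicative_ext wS).
Proof. by apply/extendsP => X x /mult_graph_ext; rewrite multiplicative_extE. Qed.

Lemma multiplicative_ext_multiplicative S (wS : weakly_multiplicative S) :
  multiplicative (multiplicative_ext wS).
Proof.
apply: multiplicativeP => X Y x y; rewrite !multiplicative_extE.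
exact: mult_graphM.
Qed.

Lemma multiplicative_ext_min S (wS : weakly_multiplicative S) S' :
  extends S S' -> multiplicative S' -> extends (multiplicative_ext wS) S'.
Proof.
move=> sSS' S'M; apply/extendsP => X x; rewrite multiplicative_extE.
exact: mult_graph_sub.
Qed.

Lemma multiplicative_ext_mono S S' (wS : weakly_multiplicative S)
    (wS' : weakly_multiplicative S') :
  extends S S' -> extends (multiplicative_ext wS) (multiplicative_ext wS').
Proof.
move=> sSS'; apply: multiplicative_ext_min.
  exact: extends_trans sSS' (multiplicative_ext_extends wS').
exact: multiplicative_ext_multiplicative.
Qed.

Lemma multiplicative_weakly S : multiplicative S -> weakly_multiplicative S.
Proof. by move=> SM; exists S; split=> //; apply: extends_refl. Qed.

Record wMSum := WMSum {
  wsum :> summation E;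
  wsumP : weakly_multiplicative wsum
}.

Lemma wMSum_eq (S S' : wMSum) : wsum S = wsum S' -> S = S'.
Proof.
by case: S S' => [S wS] [S' wS'] /= eqS; case: _ / eqS wS' => wS'; congr WMSum.
Qed.

(* A functor between posetal categories is a monotone map on objects. *)
Record wfunctor := WFunctor {
  fobj :> wMSum -> wMSum;
  fmono : forall S S' : wMSum, extends S S' -> extends (fobj S) (fobj S')
}.

Lemma wfunctor_eq (F G : wfunctor) : (forall S : wMSum, F S = G S) -> F = G.
Proof.
case: F G => [F mF] [G mG] /= /funext eqF.
by case: _ / eqF mG => mG; congr WFunctor.
Qed.

Definition fcomp (F G : wfunctor) : wfunctor :=
  @WFunctor (fun S : wMSum => F (G S))
    (fun (S S' : wMSum) sSS' => fmono F (fmono G sSS')).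

Definition extension_map (F : wfunctor) : Prop := forall S : wMSum, extends S (F S).

Definition subsumes (F G : wfunctor) : Prop := F = fcomp F G /\ F = fcomp G F.

Definition idempotent_functor (F : wfunctor) : Prop := fcomp F F = F.

Definition telescopic : wfunctor :=
  @WFunctor (fun S : wMSum => WMSum (telescopic_ext_weakly_multiplicative (wsumP S)))
    (fun S S' : wMSum => @telescopic_ext_mono S S').

Definition multiplicative_functor : wfunctor :=
  @WFunctor
    (fun S : wMSum => WMSum (multiplicative_weakly
                       (multiplicative_ext_multiplicative (wsumP S))))
    (fun S S' : wMSum => multiplicative_ext_mono (wsumP S) (wsumP S')).

End Summations.

Arguments telescopic {R} E.
Arguments multiplicative_functor {R} E.

(* Main.v *)
(* M S is the least multiplicative extension of S, and T preserves
   multiplicativity, so M fixes T (M S). Since T is idempotent (a product of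
   two polynomials with regular sums has regular sum), T fixes it too. Finally
   M (T S) is contained in T (M S), by minimality, and this yields
   T (M (T S)) = T (M S). All the identities follow from these three. *)
Require Import Defs.
From mathcomp Require Import all_boot all_order all_algebra.

Lemma telescopic_ext_idem (R : comNzRingType) (E : comAlgType R)
    (S : summation E) :
  telescopic_ext (telescopic_ext S) = telescopic_ext S.
Proof.
apply: extends_antisym; last exact: telescopic_ext_extends.
apply/extendsP => X x; rewrite !telescopic_extE.
move=> /tele_graphP[F FR]; rewrite telescopic_extE => /tele_graphP[G GR SGF].
(* [F] carries [X] into the domain of [telescopic_ext S], and [G] carries [F * X] into that of [S];
   evaluation at 1 is multiplicative. *)
apply/tele_graphP; exists (G * F)%R.
  rewrite hornerM -GRing.scalerA -[(F.[1] *: 1)%R]GRing.mul1r GRing.scalerAl.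
  exact: GRing.lregM.
by rewrite fps_of_polyM hornerM -GRing.mulrA -GRing.scalerA.
Qed.

(** Minimality applies with [S] as its own multiplicative extension. *)
Lemma multiplicative_ext_id (R : comNzRingType) (E : comAlgType R)
    (S : summation E) (wS : weakly_multiplicative S) :
  multiplicative S -> multiplicative_ext wS = S.
Proof.
move=> SM; apply: extends_antisym; last exact: multiplicative_ext_extends.
by apply: multiplicative_ext_min => //; apply: extends_refl.
Qed.

Lemma multiplicative_telescopic_extends (R : comNzRingType) (E : comAlgType R)
    (S : summation E) (wS : weakly_multiplicative S)
    (wTS : weakly_multiplicative (telescopic_ext S)) :
  extends (multiplicative_ext wTS) (telescopic_ext (multiplicative_ext wS)).
Proof.
apply: multiplicative_ext_min.
  exact/telescopic_ext_mono/multiplicative_ext_extends.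
exact/telescopic_ext_multiplicative/multiplicative_ext_multiplicative.
Qed.

Theorem theorem4p12 (R : comNzRingType) (E : comAlgType R) :
  let T := telescopic E in
  let M := multiplicative_functor E in
  let TM := fcomp T M in
  (forall S : wMSum E, multiplicative (TM S)) /\
  idempotent_functor TM /\
  extension_map TM /\
  subsumes TM M /\ subsumes TM T /\ subsumes TM (fcomp M T).
Proof.
move=> T M TM.
have TM_mult (S : wMSum E) : multiplicative (TM S).
  exact/telescopic_ext_multiplicative/multiplicative_ext_multiplicative.
have TT (S : wMSum E) : T (T S) = T S.
  exact/wMSum_eq/telescopic_ext_idem.
have M_id (S : wMSum E) : multiplicative S -> M S = S.
  by move=> SM; apply/wMSum_eq/multiplicative_ext_id.
have MM (S : wMSum E) : M (M S) = M S.
  exact/M_id/multiplicative_ext_multiplicative.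
have MTM (S : wMSum E) : M (T (M S)) = T (M S) by apply: M_id (TM_mult S).
have TMT (S : wMSum E) : T (M (T S)) = T (M S).
  apply/wMSum_eq/extends_antisym; last first.
    exact/fmono/fmono/telescopic_ext_extends.
  (* Doubling [T] on the right lets monotonicity strip one [T] from each side, leaving [M (T S)]
     inside [T (M S)]. *)
  rewrite -[X in extends _ X]telescopic_ext_idem; apply: telescopic_ext_mono.
  exact: multiplicative_telescopic_extends.
have compE (F G : wfunctor E) S : fcomp F G S = F (G S) by [].
split=> //; split; first by apply: wfunctor_eq => S; rewrite !compE MTM TT.
split.
  move=> S; apply: extends_trans (multiplicative_ext_extends (wsumP S)) _.
  exact: telescopic_ext_extends.
split; first by split; apply: wfunctor_eq => S; rewrite !compE ?MM ?MTM.
split; first by split; apply: wfunctor_eq => S; rewrite !compE ?TMT ?TT.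
(* The composites collapse as TMMT = TMT = TM and MTTM = MTM = TM. *)
by split; apply: wfunctor_eq => S; rewrite !compE ?MM ?TMT ?TT ?MTM.
Qed.
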